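(* Let $\gamma\subset\mathbb{RP}^2$, $\bar\gamma\subset\mathbb{RP}^{2*}$ be a pair of locally convex curves parametrized by a dancing pair $q(t),p(t)$ (i.e. $q(t)=[\mathbf q(t)]$, $p(t)=[\mathbf p(t)]$, where $\mathbf p\mathbf q=1$ and $\mathbf p'=\mathbf q\times\mathbf q'$). Then the map $\gamma\to\bar\gamma$, $q(t)\mapsto p(t)$, is projective, i.e. it preserves the natural projective structures on $\gamma,\bar\gamma$ induced by their embeddings in $\mathbb{RP}^2,\mathbb{RP}^{2*}$ respectively.
   Context: Columns $\mathbf q\in\mathbb R^3$, rows $\mathbf p\in(\mathbb R^3)^*$, $\mathbf p\mathbf q=p_iq^i$, $(\mathbf v\times\mathbf w)_i=\epsilon_{ijk}v^jw^k$ on $\mathbb R^3$. $\mathbb{RP}^2=\mathbb P(\mathbb R^3)$, $\mathbb{RP}^{2*}=\mathbb P((\mathbb R^3)^* )$. A projective structure on a curve is an atlas of $\mathbb{RP}^1$-valued charts with Möbius transition maps. A regular curve in a projective plane is locally convex if it has no inflection points, i.e. $\det(\mathbf q,\mathbf q',\mathbf q'')\neq0$ for a parametrized lift $\mathbf q(t)$ to the underlying 3-dimensional vector space. Such a lift satisfies a unique tautological ODE $\mathbf q'''+a_2\mathbf q''+a_1\mathbf q'+a_0\mathbf q=0$. By reparametrizing and rescaling the lift one can locally reach the Laguerre–Forsyth form $\mathbf q'''+a_0\mathbf q=0$; the parameter in this form is unique up to Möbius transformations, and these parameters are the charts of the natural projective structure on the curve. *)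

(* Defs.v *)
From HB Require Import structures.
From mathcomp Require Import all_boot all_order all_algebra.
From mathcomp Require Import all_classical all_reals all_analysis.
Import Order.TTheory GRing.Theory Num.Theory numFieldNormedType.Exports.

Set Implicit Arguments.
Unset Strict Implicit.
Unset Printing Implicit Defensive.

Local Open Scope ring_scope.
Local Open Scope classical_set_scope.

(* The projective space P(V), as the set of lines through 0 in V.  All vector
   spaces below are matrix spaces: columns 'cV[R]_3 for R^3, rows 'rV[R]_3 for
   its dual, and 'cV[R]_2 for the projective line. *)
Definition proj_space (R : realType) (m n : nat) :=
  {L : {vspace 'M[R]_(m, n)} | \dim L == 1%N}.

(* P = [v]; in particular v != 0. *)
Definition represents (R : realType) (m n : nat)
    (v : 'M[R]_(m, n)) (P : proj_space R m n) : Prop :=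
  val P = <[v]>%VS.

Definition RP1 (R : realType) := proj_space R 2 1.

Definition smooth_on (R : realType) (V : normedModType R) (I : set R)
    (q : R -> V) : Prop :=
  forall (k : nat) (t : R), I t -> derivable (q^`(k)) t 1.

(* c : I -> M is a parametrization, with smooth lift q, of the curve M mapped
   to the projective space by iota.  Linear independence of q, q' says that
   t |-> [q t] is an immersion; hence c is locally injective and, being
   continuous and open, a local homeomorphism. *)
Definition param_of (R : realType) (m n : nat) (M : topologicalType)
    (iota : M -> proj_space R m.+1 n.+1)
    (I : set R) (c : R -> M) (q : R -> 'M[R]_(m.+1, n.+1)) : Prop :=
  [/\ open I,
      smooth_on I q,
      forall t, I t -> represents (q t) (iota (c t)) /\ free [:: q t; q^`() t],
      forall t, I t -> {for t, continuous c}
    & forall J, open J -> J `<=` I -> open (c @` J)].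

(* A regular (immersed) curve in P(V): a one-dimensional manifold together with
   an immersion.  Points of the curve are points of the carrier, so that
   self-intersecting and closed curves are allowed; the smooth structure is the
   one determined by the immersion. *)
Record curve (R : realType) (m n : nat) := Curve {
  carrier :> topologicalType;
  emb : carrier -> proj_space R m.+1 n.+1;
  curve_hausdorff : hausdorff_space carrier;
  curve_regular : forall x : carrier, exists I c q,
    param_of emb I c q /\ (c @` I) x }.

Definition parametrization (R : realType) (m n : nat) (g : curve R m n)
    (I : set R) (c : R -> g) (q : R -> 'M[R]_(m.+1, n.+1)) : Prop :=
  param_of (@emb R m n g) I c q.

Definition plane_curve (R : realType) := curve R 2 0.
Definition dual_plane_curve (R : realType) := curve R 0 2.

Definition det_col (R : realType) (u v w : 'cV[R]_3) : R :=
  \det (\matrix_(i < 3, j < 3) ([:: u; v; w]`_j) i ord0).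

Definition det_row (R : realType) (u v w : 'rV[R]_3) : R :=
  \det (\matrix_(i < 3, j < 3) ([:: u; v; w]`_i) ord0 j).

(* det is meant to be det_col or det_row.  The condition does not depend on the
   parametrization or the lift, so requiring it for all of them is harmless. *)
Definition locally_convex_curve (R : realType) (m n : nat)
    (det : 'M[R]_(m.+1, n.+1) -> 'M[R]_(m.+1, n.+1) -> 'M[R]_(m.+1, n.+1) -> R)
    (g : curve R m n) : Prop :=
  forall (I : set R) (c : R -> g) (q : R -> 'M[R]_(m.+1, n.+1)),
    parametrization I c q ->
    forall t, I t -> det (q t) (q^`() t) (q^`(2) t) != 0.

Definition chart (R : realType) (M : Type) := (set M * (M -> RP1 R))%type.

Definition homog (R : realType) (s : R) : 'cV[R]_2 :=
  \col_i (if i == ord0 then s else 1).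

(* The atlas of the natural projective structure: (U, phi) with
   phi x = [s x : 1], where s is a coordinate on U whose inverse parametrizes
   the curve with a lift Q in the Laguerre-Forsyth form Q''' + a0 Q = 0. *)
Definition natural_atlas (R : realType) (m n : nat) (g : curve R m n) :
    set (chart R g) :=
  [set phi | open phi.1 /\
    exists s : g -> R,
      (forall x, phi.1 x -> represents (homog (s x)) (phi.2 x)) /\
      exists (c : R -> g) (Q : R -> 'M[R]_(m.+1, n.+1)) (a0 : R -> R),
        [/\ parametrization (s @` phi.1) c Q,
            forall x, phi.1 x -> c (s x) = x
          & forall t, (s @` phi.1) t -> (Q^`(3))%classic t + a0 t *: Q t = 0]].

(* P' = A . P for the Moebius transformation of RP1 induced by A in GL_2. *)
Definition moebius (R : realType) (A : 'M[R]_2) (P P' : RP1 R) : Prop :=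
  val P' = (linfun (mulmx A : 'cV[R]_2 -> 'cV[R]_2) @: val P)%VS.

(* Maps respecting two projective structures, given by atlases: in the charts
   they are, locally, Moebius transformations. *)
Definition projective_map (R : realType) (M N : topologicalType)
    (AM : set (chart R M)) (AN : set (chart R N)) (f : M -> N) : Prop :=
  continuous f /\
  forall (phi : chart R M) (psi : chart R N) (x : M),
    AM phi -> AN psi -> phi.1 x -> psi.1 (f x) ->
    exists A : 'M[R]_2, A \in unitmx /\
      \forall y \near x, moebius A (phi.2 y) (psi.2 (f y)).

(* (v x w)_i = epsilon_ijk v^j w^k; indices are added modulo 3. *)
Definition cross (R : realType) (v w : 'cV[R]_3) : 'rV[R]_3 :=
  \row_(i < 3) (v (i + 1) ord0 * w (i + 2%:R) ord0
                - v (i + 2%:R) ord0 * w (i + 1) ord0).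

Definition dancing_pair (R : realType) (I : set R)
    (q : R -> 'cV[R]_3) (p : R -> 'rV[R]_3) : Prop :=
  forall t, I t -> p t *m q t = 1%:M /\ p^`() t = cross (q t) ((q^`())%classic t).

(* Main.v *)
Require Import Defs.
From HB Require Import structures.
From mathcomp Require Import all_boot all_order all_algebra.
From mathcomp Require Import all_classical all_reals all_analysis.
From mathcomp Require Import ring lra.
Import Order.TTheory GRing.Theory Num.Theory numFieldNormedType.Exports.
Local Open Scope ring_scope.
Local Open Scope classical_set_scope.

(* Differentiating p q = 1 and p' = q x q' gives p'q = pq' = p'q' = p''q =
   pq'' = p''q'' = 0 and p'q'' = - p''q' = D = det(q, q', q'').  Testing
   q''' + a2 q'' + a1 q' + a0 q = 0 with p', p'', and the equation of p with
   q', q'', shows that p satisfies a tautological ODE with the same a2 and a1.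
   A Laguerre-Forsyth parameter s(t) obeys
     s''/s' = l'/l - a2/3,    2 (s''/s')' - (s''/s')^2 = a1 - a2' - a2^2/3,
   where l is the factor between the two lifts, so the parameters on the two
   curves have the same Schwarzian derivative and are related by a Moebius map. *)

Set Implicit Arguments.
Unset Strict Implicit.
Unset Printing Implicit Defensive.

(** * Calculus of real functions on open sets *)

Section Calculus.
Variable R : realType.
Implicit Types (N : set R) (f g : R -> R) (k : nat).

(* [is_derive] is a type class; hiding it keeps instance resolution from solving
   premises on its own. *)
Definition has_derive f (t df : R) : Prop := is_derive t 1 f df.

Lemma has_derive_val f (t df df' : R) :
  has_derive f t df -> df = df' -> has_derive f t df'.
Proof. by move=> H <-. Qed.

Lemma has_derive_derivable f (t df : R) : has_derive f t df -> derivable f t 1.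
Proof. by case. Qed.

Lemma has_derive_derive1 f (t df : R) : has_derive f t df -> f^`()%classic t = df.
Proof. by move=> [_ <-]; rewrite derive1E. Qed.

Lemma derivable_has_derive f (t : R) :
  derivable f t 1 -> has_derive f t (f^`()%classic t).
Proof. by move=> ?; rewrite /has_derive derive1E; apply: derivableP. Qed.

Lemma has_derive_cst (a t : R) : has_derive (fun=> a) t 0.
Proof. exact: is_derive_cst. Qed.

Lemma has_deriveD f g (t df dg : R) : has_derive f t df -> has_derive g t dg ->
  has_derive (fun x => f x + g x) t (df + dg).
Proof. exact: is_deriveD. Qed.

Lemma has_deriveM f g (t df dg : R) : has_derive f t df -> has_derive g t dg ->
  has_derive (fun x => f x * g x) t (df * g t + f t * dg).
Proof.
move=> df' dg'; have := is_deriveM df' dg'.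
by rewrite addrC -[_ *: dg]/(_ * dg) -[_ *: df]/(_ * df) (mulrC (g t)).
Qed.

Lemma has_deriveZ (a : R) f (t df : R) : has_derive f t df ->
  has_derive (fun x => a * f x) t (a * df).
Proof.
move=> dfx; apply: has_derive_val (has_deriveM (has_derive_cst a t) dfx) _.
by rewrite mul0r add0r.
Qed.

Lemma has_deriveN f (t df : R) : has_derive f t df ->
  has_derive (fun x => - f x) t (- df).
Proof. exact: is_deriveN. Qed.

Lemma has_deriveV f (t df : R) : f t != 0 -> has_derive f t df ->
  has_derive (fun x => (f x)^-1) t (- ((f t)^-1 * (f t)^-1 * df)).
Proof.
by move=> f0 df'; have := is_deriveV f0 df'; rewrite scaleNr expr2 invfM.
Qed.

Lemma has_derive_comp f g (t df dg : R) : has_derive f (g t) df ->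
  has_derive g t dg -> has_derive (fun x => f (g x)) t (df * dg).
Proof. exact: is_derive1_comp. Qed.

Lemma has_derive_sum n (h : 'I_n -> R -> R) (t : R) (dh : 'I_n -> R) :
  (forall i, has_derive (h i) t (dh i)) ->
  has_derive (fun x => \sum_i h i x) t (\sum_i dh i).
Proof.
move=> dht; have := is_derive_sum dht; congr is_derive.
by apply/funext => x; rewrite fct_sumE.
Qed.

Lemma derive1_eq_on N f g (t : R) : open N -> (forall x, N x -> f x = g x) -> N t ->
  f^`()%classic t = g^`()%classic t.
Proof.
move=> oN fg Nt; rewrite !derive1E; apply: near_eq_derive.
by near=> x; apply: fg; near: x; exact: open_nbhs_nbhs.
Unshelve. all: by end_near. Qed.

Lemma derivable_eq_on N f g (t : R) : open N -> (forall x, N x -> f x = g x) -> N t ->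
  derivable f t 1 -> derivable g t 1.
Proof.
move=> oN fg Nt; apply: near_eq_derivable.
by near=> x; apply: fg; near: x; exact: open_nbhs_nbhs.
Unshelve. all: by end_near. Qed.

(** This is k-fold differentiability at the points of [N]; continuity of the k-th derivative is left
    out because smoothness is always stated as [forall k, Ck k N f]. Recursion through the
    derivative of [f] lets inductions on k generalize over the function. *)
Fixpoint Ck k N f : Prop :=
  if k is k'.+1 then (forall t, N t -> derivable f t 1) /\ Ck k' N f^`()%classic
  else True.

Lemma CkW k N f : Ck k.+1 N f -> Ck k N f.
Proof. by elim: k f => [//|k ih] f [df] /ih ?; split. Qed.

(** Derivatives at points of an open set see only the values on that set. This is what allows a
    derivative to be replaced by a formula valid only on [N]. *)
Lemma Ck_eq_on k N f g : open N -> (forall t, N t -> f t = g t) ->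
  Ck k N f -> Ck k N g.
Proof.
move=> oN; elim: k f g => [//|k ih] f g fg [df cf]; split.
  by move=> t Nt; exact: (derivable_eq_on oN fg Nt (df t Nt)).
by apply: ih cf => t Nt; exact: derive1_eq_on fg Nt.
Qed.

Lemma Ck_subset k N N' f : N' `<=` N -> Ck k N f -> Ck k N' f.
Proof.
move=> NN'; elim: k f => [//|k ih] f [df] /ih ?; split=> // t /NN'.
exact: df.
Qed.

Lemma CkD k N f g : open N -> Ck k N f -> Ck k N g ->
  Ck k N (fun t => f t + g t).
Proof.
move=> oN; elim: k f g => [//|k ih] f g [df cf] [dg cg]; split.
  by move=> t Nt; apply: derivableD; [exact: df|exact: dg].
apply: (@Ck_eq_on _ _ (fun t => f^`()%classic t + g^`()%classic t)) => //.
  move=> t Nt; apply/esym/has_derive_derive1/has_deriveD.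
    exact/derivable_has_derive/df.
  exact/derivable_has_derive/dg.
exact: ih.
Qed.

Lemma CkM k N f g : open N -> Ck k N f -> Ck k N g ->
  Ck k N (fun t => f t * g t).
Proof.
move=> oN; elim: k f g => [//|k ih] f g cf cg.
case: (cf) => df cf'; case: (cg) => dg cg'; split.
  by move=> t Nt; apply: derivableM; [exact: df|exact: dg].
apply: (@Ck_eq_on _ _
  (fun t => f^`()%classic t * g t + f t * g^`()%classic t)) => //.
  move=> t Nt; apply/esym/has_derive_derive1/has_deriveM.
    exact/derivable_has_derive/df.
  exact/derivable_has_derive/dg.
by apply: CkD => //; apply: ih => //; exact: CkW.
Qed.

Lemma Ck_cst k N (a : R) : open N -> Ck k N (fun=> a).
Proof.
move=> oN; elim: k a => [//|k ih] a; split; first by move=> t _; exact: derivable_cst.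
by apply: Ck_eq_on (ih 0) => // t Nt; rewrite derive1_cst.
Qed.

Lemma CkN k N f : open N -> Ck k N f -> Ck k N (fun t => - f t).
Proof.
move=> oN cf.
apply: (@Ck_eq_on _ _ (fun t => -1 * f t)) => //.
  by move=> t _; rewrite mulN1r.
by apply: CkM => //; exact: Ck_cst.
Qed.

Lemma CkV k N f : open N -> (forall t, N t -> f t != 0) -> Ck k N f ->
  Ck k N (fun t => (f t)^-1).
Proof.
move=> oN f0; elim: k => [//|k ih] cf; case: (cf) => df cf'; split.
  by move=> t Nt; apply: derivableV; [exact: f0|exact: df].
apply: (@Ck_eq_on _ _ (fun t => - ((f t)^-1 * (f t)^-1 * f^`()%classic t))) => //.
  move=> t Nt; apply/esym/has_derive_derive1/has_deriveV; first exact: f0.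
  exact/derivable_has_derive/df.
have /ih cv := CkW cf.
by apply: CkN => //; do 2 apply: CkM => //.
Qed.

Lemma Ck_comp k N N' f g : open N -> open N' -> (forall t, N t -> N' (g t)) ->
  Ck k N' f -> Ck k N g -> Ck k N (f \o g).
Proof.
move=> oN oN' gN; elim: k f => [//|k ih] f cf cg.
case: (cf) => df cf'; case: (cg) => dg cg'.
have fg t : N t -> has_derive (f \o g) t (f^`()%classic (g t) * g^`()%classic t).
  move=> Nt; apply: has_derive_comp; first exact/derivable_has_derive/df/gN.
  exact/derivable_has_derive/dg.
split.
  by move=> t /fg/has_derive_derivable.
apply: (@Ck_eq_on _ _ (fun t => (f^`()%classic \o g) t * g^`()%classic t)) => //.
  by move=> t /fg/has_derive_derive1 ->.
by apply: CkM => //; apply: ih => //; exact: CkW.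
Qed.

Lemma Ck_continuous k N f (t : R) : Ck k.+1 N f -> N t -> {for t, continuous f}.
Proof.
by move=> [df _] Nt; apply/differentiable_continuous/derivable1_diffP/df.
Qed.

Lemma has_derive0_cst_on f (a b : R) :
  (forall t, t \in `]a, b[%R -> has_derive f t 0) ->
  forall x y, x \in `]a, b[%R -> y \in `]a, b[%R -> f x = f y.
Proof.
move=> df x y.
wlog xy : x y / x <= y => [H xI yI|xI yI].
  by have [/H ->//|/ltW yx] := leP x y; rewrite (H y x).
have sub z : z \in `[x, y]%R -> z \in `]a, b[%R.
  move: xI yI; rewrite !in_itv /= => /andP[ax _] /andP[_ yb] /andP[xz zy].
  by rewrite (lt_le_trans ax xz) (le_lt_trans zy yb).
have dxy z : z \in `]x, y[%R -> is_derive z 1 f ((fun=> 0) z).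
  by move=> zI; apply/df/sub; exact: subset_itv_oo_cc.
have cxy : {within `[x, y], continuous f}.
  by apply: derivable_within_continuous => z /sub/df[].
have [z _] := MVT_segment xy dxy cxy.
by rewrite mul0r => /eqP; rewrite subr_eq0 => /eqP.
Qed.

(* Caratheodory: u t - u t0 = K t (t - t0) and v y - v (s t0) = H y (y - s t0),
   so s t - s t0 = (K t / H (s t)) (t - t0). *)
Lemma has_derive_implicit (u v s : R -> R) (t0 du dv : R) :
  {for t0, continuous s} -> (\forall t \near t0, v (s t) = u t) ->
  has_derive u t0 du -> has_derive v (s t0) dv -> dv != 0 ->
  has_derive s t0 (du / dv).
Proof.
move=> sc vsu /is_derive1_caratheodory[K [KE Kc K0]].
move=> /is_derive1_caratheodory[H [HE Hc H0]] dv0.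
(* The Caratheodory slope of [s] at [t0]: the difference quotient, completed at [t0] by the expected
   derivative. Only its continuity at [t0] needs work. *)
pose g t := if t == t0 then du / dv else (s t - s t0) / (t - t0).
have gt0 : g t0 = du / dv by rewrite /g eqxx.
apply/is_derive1_caratheodory; exists g; split=> //.
  move=> t; rewrite /g; case: eqP => [->|/eqP]; first by rewrite !subrr mulr0.
  by rewrite -subr_eq0 => /divfK->.
have Hsc : H (s t) @[t --> t0] --> dv.
  by rewrite -H0; apply: (continuous_comp sc Hc).
have Hs0 : \forall t \near t0, H (s t) != 0.
  exact: (cvgr_neq0 _ Hsc dv0).
suff : g t @[t --> t0] --> du / dv by rewrite -gt0.
have : K t / H (s t) @[t --> t0] --> du / dv.
  by rewrite -{1}K0; apply: cvgM => //; exact: cvgV.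
apply: cvg_trans; apply: near_eq_cvg; near=> t.
have Ht : H (s t) != 0 by near: t.
rewrite /g; case: eqP => [->|/eqP tt0]; first by rewrite K0 H0.
have e : H (s t) * (s t - s t0) = K t * (t - t0).
  rewrite -HE -KE (nbhs_singleton vsu); congr (_ - _).
  by near: t.
have tt : t - t0 != 0 by rewrite subr_eq0.
apply: (mulIf tt); rewrite divfK//; apply: (mulfI Ht).
by rewrite e; field.
Unshelve. all: by end_near. Qed.

(** Bootstrapping: s' = u' / (v' o s), so if [s] is k times differentiable then so is the right-hand
    side, and [s] gains one derivative. The start is mere continuity of [s]. *)
Lemma Ck_implicit N N' (u v s : R -> R) : open N -> open N' ->
  (forall t, N t -> N' (s t)) -> (forall t, N t -> {for t, continuous s}) ->
  (forall t, N t -> v (s t) = u t) -> (forall y, N' y -> v^`()%classic y != 0) ->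
  (forall k, Ck k N u) -> (forall k, Ck k N' v) -> forall k, Ck k N s.
Proof.
move=> oN oN' sN sc vsu v0 cu cv.
have ds t : N t -> has_derive s t (u^`()%classic t / v^`()%classic (s t)).
  move=> Nt; apply: (@has_derive_implicit u v) => //.
  - exact: sc.
  - by near=> x; apply: vsu; near: x; exact: open_nbhs_nbhs.
  - by apply: derivable_has_derive; apply: (cu 1%N).1.
  - by apply: derivable_has_derive; apply: (cv 1%N).1; exact: sN.
  - by apply: v0; exact: sN.
elim=> [//|k ih]; split; first by move=> t /ds/has_derive_derivable.
apply: (@Ck_eq_on _ _
  (fun t => u^`()%classic t * ((v^`()%classic \o s) t)^-1)) => //.
  by move=> t /ds /has_derive_derive1.
apply: CkM => //; first exact: (cu k.+1).2.
apply: CkV => //; first by move=> t Nt /=; apply: v0; exact: sN.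
by apply: (@Ck_comp _ N N') => //; exact: (cv k.+1).2.
Unshelve. all: by end_near. Qed.

End Calculus.

(** * Functions with equal Schwarzian derivatives *)

Section Schwarzian.
Variable R : realType.

(* With h = s2 / s1 and k = r2 / r1 the hypothesis on d = h - k is
   2 d' = h^2 - k^2, i.e., s and r have the same Schwarzian derivative
   h' - h^2 / 2.  Then d^2 / (s1 r1), s1 / d - s / 2 and r1 / d + r / 2 are
   constant, which is a Moebius relation between s and r. *)
Lemma same_schwarzian_moebius (a b : R) (s s1 s2 r r1 r2 d : R -> R) :
  (forall t, t \in `]a, b[%R -> [/\ has_derive s t (s1 t),
     has_derive s1 t (s2 t), has_derive r t (r1 t) & has_derive r1 t (r2 t)]) ->
  (forall t, t \in `]a, b[%R -> s1 t != 0 /\ r1 t != 0) ->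
  (forall t, t \in `]a, b[%R -> d t = s2 t / s1 t - r2 t / r1 t) ->
  (forall t, t \in `]a, b[%R ->
     has_derive d t (((s2 t / s1 t) ^+ 2 - (r2 t / r1 t) ^+ 2) / 2)) ->
  forall t0 t, t0 \in `]a, b[%R -> t \in `]a, b[%R ->
  (r t - r t0) * (s1 t0 + d t0 / 2 * (s t - s t0)) = r1 t0 * (s t - s t0).
Proof.
move=> ds n0 dE dd t0 t t0I tI.
have [s10 r10] := n0 _ t0I; have [s1t r1t] := n0 _ tI.
have Kcst x : x \in `]a, b[%R -> d x * d x * ((s1 x)^-1 * (r1 x)^-1)
            = d t0 * d t0 * ((s1 t0)^-1 * (r1 t0)^-1).
  move=> xI; apply: (has_derive0_cst_on
    (f := fun x => d x * d x * ((s1 x)^-1 * (r1 x)^-1)) _ xI t0I) => {xI}x xI.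
  have [xs xs1 xr xr1] := ds _ xI; have [s1x r1x] := n0 _ xI.
  have xd := dd _ xI.
  apply: (has_derive_val (has_deriveM (has_deriveM xd xd)
    (has_deriveM (has_deriveV s1x xs1) (has_deriveV r1x xr1)))).
  by rewrite dE //; field; rewrite s1x r1x.
(* By constancy of d^2 / (s1 r1), d vanishes everywhere or nowhere. If it vanishes, r1 / s1 is
   constant and r is an affine function of s. *)
have [d0|d0] := eqVneq (d t0) 0.
  have d_0 x : x \in `]a, b[%R -> d x = 0.
    move=> xI; have [s1x r1x] := n0 _ xI; have := Kcst _ xI.
    by rewrite d0 !mul0r => /eqP; rewrite !mulf_eq0 !invr_eq0 (negPf s1x)
      (negPf r1x) !orbF orbb => /eqP.
  have rs_cst x : x \in `]a, b[%R -> r1 x * (s1 x)^-1 = r1 t0 * (s1 t0)^-1.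
    move=> xI; apply: (has_derive0_cst_on
      (f := fun x => r1 x * (s1 x)^-1) _ xI t0I) => {xI}x xI.
    have [xs xs1 xr xr1] := ds _ xI; have [s1x r1x] := n0 _ xI.
    apply: (has_derive_val (has_deriveM xr1 (has_deriveV s1x xs1))).
    have /eqP := d_0 _ xI; rewrite dE// subr_eq0 => /eqP e.
    have -> : r2 x = s2 x / s1 x * r1 x by rewrite e divfK.
    by field.
  have : r t + - (r1 t0 * (s1 t0)^-1) * s t
         = r t0 + - (r1 t0 * (s1 t0)^-1) * s t0.
    apply: (has_derive0_cst_on
      (f := fun x => r x + - (r1 t0 * (s1 t0)^-1) * s x) _ tI t0I) => x xI.
    have [xs xs1 xr xr1] := ds _ xI; have [s1x r1x] := n0 _ xI.
    apply: (has_derive_val (has_deriveD xr (has_deriveZ _ xs))).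
    by rewrite -(rs_cst _ xI); field.
  move=> /(canRL (addrK _)) ->; rewrite d0; field; exact: s10.
have dneq0 x : x \in `]a, b[%R -> d x != 0.
  move=> xI; apply: contra_neq d0 => dx0; apply/eqP.
  have /eqP := Kcst _ xI; rewrite dx0 !mul0r eq_sym !mulf_eq0 !invr_eq0.
  by rewrite (negPf s10) (negPf r10) !orbF orbb.
have sE : s1 t * (d t)^-1 + - 2^-1 * s t = s1 t0 * (d t0)^-1 + - 2^-1 * s t0.
  apply: (has_derive0_cst_on
    (f := fun x => s1 x * (d x)^-1 + - 2^-1 * s x) _ tI t0I) => x xI.
  have [xs xs1 xr xr1] := ds _ xI; have [s1x r1x] := n0 _ xI.
  have dx := dneq0 _ xI.
  apply: (has_derive_val (has_deriveD
    (has_deriveM xs1 (has_deriveV dx (dd _ xI))) (has_deriveZ _ xs))).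
  apply: (mulIf dx); apply: (mulIf dx); rewrite mul0r mul0r.
  rewrite -[LHS]/(_ * d x * d x).
  (* Eliminating [s2] by h = d + k leaves d, s1, r1, r2 as independent variables for [field]. *)
  have -> : s2 x = (d x + r2 x / r1 x) * s1 x by rewrite dE// subrK divfK.
  by field; rewrite dx s1x r1x.
have rE : r1 t * (d t)^-1 + 2^-1 * r t = r1 t0 * (d t0)^-1 + 2^-1 * r t0.
  apply: (has_derive0_cst_on
    (f := fun x => r1 x * (d x)^-1 + 2^-1 * r x) _ tI t0I) => x xI.
  have [xs xs1 xr xr1] := ds _ xI; have [s1x r1x] := n0 _ xI.
  have dx := dneq0 _ xI.
  apply: (has_derive_val (has_deriveD
    (has_deriveM xr1 (has_deriveV dx (dd _ xI))) (has_deriveZ _ xr))).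
  have -> : s2 x = (d x + r2 x / r1 x) * s1 x by rewrite dE// subrK divfK.
  by field; rewrite dx s1x r1x.
have dt := dneq0 _ tI.
have inv x : x \in `]a, b[%R -> s1 x * (d x)^-1 * (r1 x * (d x)^-1)
    = (d x * d x * ((s1 x)^-1 * (r1 x)^-1))^-1.
  move=> xI; have [s1x r1x] := n0 _ xI; have dx := dneq0 _ xI.
  by field; rewrite dx s1x r1x.
have := inv _ tI; rewrite Kcst// -inv// (canRL (addrK _) sE) (canRL (addrK _) rE).
move=> prodE; apply/eqP; rewrite -subr_eq0; apply/eqP.
(* The product of s1 / d and r1 / d is constant, and each factor is a constant plus s / 2 or minus r
   / 2. The difference of this product between t and t0, times -2 d(t0), is the difference of the
   two sides of the goal. *)
transitivity (- 2 * d t0 *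
  ((s1 t0 * (d t0)^-1 + - 2^-1 * s t0 - - 2^-1 * s t) *
   (r1 t0 * (d t0)^-1 + 2^-1 * r t0 - 2^-1 * r t)
   - s1 t0 * (d t0)^-1 * (r1 t0 * (d t0)^-1))).
  by field.
by rewrite prodE subrr mulr0.
Qed.

End Schwarzian.

(** * Third-order jets under reparametrization and rescaling *)

Section Jets.
Local Arguments derive1n {R V} n f : simpl never.
Local Notation "f ^` ( n )" := (derive1n n f) : ring_scope.
Variable R : realType.
Implicit Types (N : set R) (f g s l : R -> R).

Lemma Ck_has_derive N f n (t : R) : (forall k, Ck k N f) -> N t ->
  has_derive (f^`(n)) t ((f^`(n.+1)) t).
Proof.
move=> cf Nt; apply: derivable_has_derive.
elim: n f cf => [|n ih] f cf; first exact: (cf 1%N).1.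
by rewrite derive1Sn; apply: ih => k; exact: (cf k.+1).2.
Qed.

(** These are the first three derivatives of f o s = l g, by the chain and Leibniz rules. In use, g
    is a coordinate of the given lift, f the same coordinate of the Laguerre-Forsyth lift, and s the
    change of parameter. *)
Lemma derive1n_comp_mul N N' f g s l : open N -> open N' ->
  (forall t, N t -> N' (s t)) ->
  (forall k, Ck k N' f) -> (forall k, Ck k N g) ->
  (forall k, Ck k N s) -> (forall k, Ck k N l) ->
  (forall t, N t -> f (s t) = l t * g t) -> forall t, N t ->
  [/\ (s^`(1)) t * (f^`(1)) (s t) =
        (l^`(1)) t * g t + l t * (g^`(1)) t,
      (s^`(1)) t ^+ 2 * (f^`(2)) (s t)
        + (s^`(2)) t * (f^`(1)) (s t) =
        (l^`(2)) t * g t + 2 * (l^`(1)) t * (g^`(1)) t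
        + l t * (g^`(2)) t
    & (s^`(1)) t ^+ 3 * (f^`(3)) (s t)
        + 3 * (s^`(1)) t * (s^`(2)) t * (f^`(2)) (s t)
        + (s^`(3)) t * (f^`(1)) (s t) =
        (l^`(3)) t * g t + 3 * (l^`(2)) t * (g^`(1)) t
        + 3 * (l^`(1)) t * (g^`(2)) t
        + l t * (g^`(3)) t].
Proof.
move=> oN oN' sN cf cg cs cl e0.
have df n t : N t -> has_derive (fun x => (f^`(n)) (s x)) t
    ((f^`(n.+1)) (s t) * (s^`(1)) t).
  move=> Nt; apply: has_derive_comp; last exact: (Ck_has_derive 0 cs Nt).
  exact: Ck_has_derive cf (sN _ Nt).
have dg n t : N t -> _ := fun Nt => Ck_has_derive n cg Nt.
have ds n t : N t -> _ := fun Nt => Ck_has_derive n cs Nt.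
have dl n t : N t -> _ := fun Nt => Ck_has_derive n cl Nt.
have same u v (du dv t : R) : (forall x, N x -> u x = v x) -> N t ->
    has_derive u t du -> has_derive v t dv -> du = dv.
  move=> uv Nt /has_derive_derive1 <- /has_derive_derive1 <-.
  exact: derive1_eq_on uv Nt.
have e1 t : N t -> (s^`(1)) t * (f^`(1)) (s t) =
    (l^`(1)) t * g t + l t * (g^`(1)) t.
  move=> Nt; rewrite [LHS]mulrC.
  exact: same e0 Nt (df 0 t Nt) (has_deriveM (dl 0 t Nt) (dg 0 t Nt)).
have e2 t : N t -> (s^`(1)) t ^+ 2 * (f^`(2)) (s t)
        + (s^`(2)) t * (f^`(1)) (s t) =
        (l^`(2)) t * g t + 2 * (l^`(1)) t * (g^`(1)) t
        + l t * (g^`(2)) t.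
  move=> Nt; have := same _ _ _ _ _ e1 Nt
    (has_deriveM (ds 1 t Nt) (df 1 t Nt))
    (has_deriveD (has_deriveM (dl 1 t Nt) (dg 0 t Nt))
                 (has_deriveM (dl 0 t Nt) (dg 1 t Nt))).
  (* The derivatives are generalized to plain numbers, so that [ring] only rearranges
     polynomials. *)
  rewrite !derive1n0; move: (s^`(1) t) (s^`(2) t) (f^`(1) (s t)) (f^`(2) (s t))
    (l t) (l^`(1) t) (l^`(2) t) (g t) (g^`(1) t) (g^`(2) t).
  by move=> s1 s2 f1 f2 l0 l1 l2 g0 g1 g2 e; apply: (etrans _ (etrans e _)); ring.
move=> t Nt; split; [exact: e1|exact: e2|].
have := same _ _ _ _ _ e2 Nt
    (has_deriveD (has_deriveM (has_deriveM (ds 1 t Nt) (ds 1 t Nt)) (df 2 t Nt))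
                 (has_deriveM (ds 2 t Nt) (df 1 t Nt)))
    (has_deriveD (has_deriveD (has_deriveM (dl 2 t Nt) (dg 0 t Nt))
                 (has_deriveM (has_deriveZ 2 (dl 1 t Nt)) (dg 1 t Nt)))
                 (has_deriveM (dl 0 t Nt) (dg 2 t Nt))).
rewrite !derive1n0; move: (s^`(1) t) (s^`(2) t) (s^`(3) t)
  (f^`(1) (s t)) (f^`(2) (s t)) (f^`(3) (s t))
  (l t) (l^`(1) t) (l^`(2) t) (l^`(3) t) (g t) (g^`(1) t) (g^`(2) t) (g^`(3) t).
by move=> s1 s2 s3 f1 f2 f3 l0 l1 l2 l3 g0 g1 g2 g3 e; apply: (etrans _ (etrans e _)); ring.
Qed.

(** Vectors are families of coordinates here, so that the same lemmas serve columns and rows. *)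
Definition pairing (T : finType) (c F : T -> R) : R := \sum_i c i * F i.

Lemma pairingD (T : finType) (c F G : T -> R) :
  pairing c (fun i => F i + G i) = pairing c F + pairing c G.
Proof. by rewrite -big_split; apply: eq_bigr => i _; rewrite mulrDr. Qed.

Lemma pairingZ (T : finType) (c F : T -> R) (x : R) :
  pairing c (fun i => x * F i) = x * pairing c F.
Proof. by rewrite mulr_sumr; apply: eq_bigr => i _; rewrite mulrCA. Qed.

Lemma eq_pairing (T : finType) (c F G : T -> R) :
  F =1 G -> pairing c F = pairing c G.
Proof. by move=> FG; apply: eq_bigr => i _; rewrite FG. Qed.

(* The test functionals a and b extract from x3 + a2 x2 + a1 x1 + a0 x0 = 0
   its coefficients a2 = - B / D and a1 = E / D. *)
Lemma Laguerre_Forsyth_relations (T : finType)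
    (x0 x1 x2 x3 y0 y1 y2 y3 a b : T -> R)
    (s1 s2 s3 l0 l1 l2 l3 c B D E : R) :
  (forall i, y0 i = l0 * x0 i) ->
  (forall i, [/\ s1 * y1 i = l1 * x0 i + l0 * x1 i,
     s1 ^+ 2 * y2 i + s2 * y1 i = l2 * x0 i + 2 * l1 * x1 i + l0 * x2 i
   & s1 ^+ 3 * y3 i + 3 * s1 * s2 * y2 i + s3 * y1 i
     = l3 * x0 i + 3 * l2 * x1 i + 3 * l1 * x2 i + l0 * x3 i]) ->
  (forall i, y3 i + c * y0 i = 0) ->
  l0 != 0 -> D != 0 ->
  [/\ pairing a x0 = 0, pairing a x1 = 0, pairing a x2 = D & pairing a x3 = B] ->
  [/\ pairing b x0 = 0, pairing b x1 = - D, pairing b x2 = 0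
    & pairing b x3 = E] ->
  [/\ s1 != 0, s2 / s1 = l1 / l0 + B / (3 * D)
    & 3 * (s2 / s1) ^+ 2 - 6 * (s2 / s1) * (l1 / l0) - s3 / s1 + 3 * (l2 / l0)
      = E / D].
Proof.
move=> e0 J ode l00 D0 [aX0 aX1 aX2 aX3] [bX0 bX1 bX2 bX3].
have P1 d : s1 * pairing d y1 = l1 * pairing d x0 + l0 * pairing d x1.
  by rewrite -!pairingZ -!pairingD; apply: eq_pairing => i; case: (J i).
have P2 d : s1 ^+ 2 * pairing d y2 + s2 * pairing d y1
    = l2 * pairing d x0 + 2 * l1 * pairing d x1 + l0 * pairing d x2.
  by rewrite -!pairingZ -!pairingD; apply: eq_pairing => i; case: (J i).
have P3 d : s1 ^+ 3 * pairing d y3 + 3 * s1 * s2 * pairing d y2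
      + s3 * pairing d y1
    = l3 * pairing d x0 + 3 * l2 * pairing d x1 + 3 * l1 * pairing d x2
      + l0 * pairing d x3.
  by rewrite -!pairingZ -!pairingD; apply: eq_pairing => i; case: (J i).
(* In Laguerre-Forsyth form y3 is a multiple of y0, hence of x0, so a functional that kills x0 also
   kills y3. *)
have P30 d : pairing d x0 = 0 -> pairing d y3 = 0.
  move=> dx0; transitivity (- c * l0 * pairing d x0); last by rewrite dx0 mulr0.
  rewrite -pairingZ; apply: eq_pairing => i.
  by have /eqP := ode i; rewrite addr_eq0 => /eqP ->; rewrite e0 -mulrA mulNr.
move: (P1 a) (P2 a) (P3 a) (P1 b) (P2 b) (P3 b).
rewrite !P30// aX0 aX1 aX2 aX3 bX0 bX1 bX2 bX3 !(mulr0, add0r, addr0).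
move=> A1 A2 A3 B1 B2 B3.
(* [B1] is s1 (b y1) = - l0 D, whose right-hand side is nonzero. *)
have s10 : s1 != 0.
  apply: contraNneq D0 => s10; move: B1 => /eqP.
  by rewrite s10 mul0r eq_sym mulf_eq0 (negPf l00) oppr_eq0.
have a10 : pairing a y1 = 0 by apply: (mulfI s10); rewrite A1 mulr0.
have b1E : pairing b y1 = - (l0 * D / s1).
  by apply: (mulfI s10); rewrite B1; field.
rewrite a10 !(mulr0, addr0) in A2 A3.
have a2E : pairing a y2 = l0 * D / s1 ^+ 2.
  by rewrite -A2; field.
have b2E : pairing b y2 = (s2 / s1 * l0 - 2 * l1) * D / s1 ^+ 2.
  apply: (mulfI (expf_neq0 2 s10)); move: B2 => /(canRL (addrK _)) ->.
  by rewrite b1E; field.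
(* The third-order relations are now 3 s1 s2 (a y2) = 3 l1 D + l0 B and 3 s1 s2 (b y2) + s3 (b y1) =
   - 3 l2 D + l0 E. Solving them for B and E gives the two claims. *)
split=> //.
  have BE : B = (3 * s1 * s2 * (l0 * D / s1 ^+ 2) - 3 * l1 * D) / l0.
    by rewrite -a2E A3; field.
  by rewrite BE; field; rewrite l00 D0 s10.
have EE : E = (3 * s1 * s2 * pairing b y2 + s3 * pairing b y1 + 3 * l2 * D) / l0.
  by rewrite B3; field.
by rewrite EE b1E b2E; field; rewrite l00 D0 s10.
Qed.

End Jets.

(** * Products of the derivatives of a dancing pair *)

Section Dancing.
Variable R : realType.
Local Notation "f ^` ( n )" := (derive1n n f) : ring_scope.

Lemma sum3E (F : 'I_3 -> R) : \sum_i F i = F 0 + F 1 + F 2%:R.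
Proof.
rewrite !big_ord_recl big_ord0 addr0 addrA.
by congr (_ + F _ + F _); apply: val_inj.
Qed.

(** The scalar triple product (x × y) z, with indices modulo 3 as in [cross]. *)
Definition triple (x y z : 'I_3 -> R) : R :=
  \sum_i (x (i + 1) * y (i + 2%:R) - x (i + 2%:R) * y (i + 1)) * z i.

Let add3E : (((0 + 1 = 1 :> 'I_3)%R * (0 + 2%:R = 2%:R :> 'I_3)%R) *
  ((1 + 1 = 2%:R :> 'I_3)%R * (1 + 2%:R = 0 :> 'I_3)%R) *
  ((2%:R + 1 = 0 :> 'I_3)%R * (2%:R + 2%:R = 1 :> 'I_3)%R))%type.
Proof. by split; [split; split|split]; apply: val_inj. Qed.

Lemma triple_l (x y : 'I_3 -> R) : triple x y x = 0.
Proof. by rewrite /triple sum3E !add3E; ring. Qed.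

Lemma triple_r (x y : 'I_3 -> R) : triple x y y = 0.
Proof. by rewrite /triple sum3E !add3E; ring. Qed.

Lemma det_colE (u v w : 'cV[R]_3) :
  det_col u v w = triple (fun i => u i ord0) (fun i => v i ord0) (fun i => w i ord0).
Proof.
rewrite /det_col (expand_det_row _ 0) /triple !sum3E !add3E /cofactor.
rewrite !(expand_det_row _ ord0) !big_ord_recl !big_ord0 /cofactor !det_mx11 !mxE /=.
have l1 : lift 0 ord0 = 1 :> 'I_3 by apply: val_inj.
have l2 : lift 0 (lift ord0 0) = 2%:R :> 'I_3 by apply: val_inj.
have m1 : (1 %% 3)%N = 1%N by [].
have m2 : ((1 %% 3 + 1 %% 3) %% 3)%N = 2%N by [].
rewrite m2 m1 l1 l2 /bump /= !add0n expr0 expr1 expr2.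
by ring.
Qed.

Section Relations.
Variables (I : set R) (x p : 'I_3 -> R -> R).
Hypotheses (oI : open I) (cx : forall i k, Ck k I (x i))
  (cp : forall i k, Ck k I (p i)).
Hypothesis px1 : forall t, I t -> pairing (p^~ t) (x^~ t) = 1.
Hypothesis p1E : forall t, I t -> forall i, (p i)^`(1) t =
  x (i + 1) t * (x (i + 2%:R))^`(1) t - x (i + 2%:R) t * (x (i + 1))^`(1) t.

Let A m n t := pairing (fun i => (p i)^`(m) t) (fun i => (x i)^`(n) t).

Lemma pairingNC (a b : 'I_3 -> R) : pairing (fun i => - a i) b = - pairing b a.
Proof. by rewrite -sumrN; apply: eq_bigr => i _; rewrite mulNr mulrC. Qed.

Let dA m n t : I t -> has_derive (A m n) t (A m.+1 n t + A m n.+1 t).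
Proof.
move=> It; rewrite /A /pairing -big_split; apply: has_derive_sum => i.
by apply: has_deriveM; exact: Ck_has_derive.
Qed.

(** Since [A m n] is p^(m) q^(n), each entry of this table that is known on [I] gives, by
    differentiation, a linear relation between two entries of the next order. *)
Let A_leibniz m n f t df : I t -> (forall u, I u -> A m n u = f u) ->
  has_derive f t df -> A m.+1 n t + A m n.+1 t = df.
Proof.
move=> It Af /has_derive_derive1 <-; rewrite -(has_derive_derive1 (dA m n It)).
exact: derive1_eq_on Af It.
Qed.

(** The derivative of q × q' is q × q'', since q' × q' = 0. *)
Let p2E t i : I t -> (p i)^`(2) t =
  x (i + 1) t * (x (i + 2%:R))^`(2) t - x (i + 2%:R) t * (x (i + 1))^`(2) t.
Proof.
move=> It; have dx n j := Ck_has_derive n (cx j) It.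
rewrite -(has_derive_derive1 (Ck_has_derive 1 (cp i) It)).
rewrite (derive1_eq_on oI (fun u Iu => p1E Iu i) It).
apply: (etrans (has_derive_derive1 (has_deriveD
  (has_deriveM (dx 0%N (i + 1)) (dx 1%N (i + 2%:R)))
  (has_deriveN (has_deriveM (dx 0%N (i + 2%:R)) (dx 1%N (i + 1))))))).
rewrite !derive1n0.
move: ((x (i + 1)) t) ((x (i + 1))^`(1) t) ((x (i + 1))^`(2) t)
  ((x (i + 2%:R)) t) ((x (i + 2%:R))^`(1) t) ((x (i + 2%:R))^`(2) t).
by move=> a0 a1 a2 b0 b1 b2; ring.
Qed.

(** The lift q is tested with p', p'' and the lift p with - q', - q''. The signs are chosen so that
    both tests give the same D, B = p'q''' and E = p''q''', hence the same coefficients a2 and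
    a1. *)
Lemma dancing_relations t (q0 q1 q2 q3 p0 p1 p2 p3 : 'I_3 -> R) : I t ->
  q0 =1 x^~ t -> q1 =1 (fun i => (x i)^`(1) t) ->
  q2 =1 (fun i => (x i)^`(2) t) -> q3 =1 (fun i => (x i)^`(3) t) ->
  p0 =1 p^~ t -> p1 =1 (fun i => (p i)^`(1) t) ->
  p2 =1 (fun i => (p i)^`(2) t) -> p3 =1 (fun i => (p i)^`(3) t) ->
  let D := triple q0 q1 q2 in exists B E,
  [/\ [/\ pairing p1 q0 = 0, pairing p1 q1 = 0, pairing p1 q2 = D
        & pairing p1 q3 = B],
      [/\ pairing p2 q0 = 0, pairing p2 q1 = - D, pairing p2 q2 = 0
        & pairing p2 q3 = E],
      [/\ pairing (fun i => - q1 i) p0 = 0, pairing (fun i => - q1 i) p1 = 0,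
          pairing (fun i => - q1 i) p2 = D & pairing (fun i => - q1 i) p3 = B]
    & [/\ pairing (fun i => - q2 i) p0 = 0, pairing (fun i => - q2 i) p1 = - D,
          pairing (fun i => - q2 i) p2 = 0 & pairing (fun i => - q2 i) p3 = E]].
Proof.
move=> It /funext -> /funext -> /funext -> /funext -> /funext -> /funext ->
  /funext -> /funext -> D.
rewrite !pairingNC.
have A00 u : I u -> A 0 0 u = 1 by exact: px1.
(* Entries 10, 11, 12 and 22 are triple products, by p' = q × q' and p'' = q × q''; the remaining
   ones follow by differentiating known entries. *)
have A10 u : I u -> A 1 0 u = 0.
  move=> Iu; rewrite -[RHS](triple_l (x^~ u) (fun i => (x i)^`(1) u)).
  by apply: eq_bigr => i _; rewrite p1E.
have A11 u : I u -> A 1 1 u = 0.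
  move=> Iu; rewrite -[RHS](triple_r (x^~ u) (fun i => (x i)^`(1) u)).
  by apply: eq_bigr => i _; rewrite p1E.
have A12 : A 1 2 t = D by apply: eq_bigr => i _; rewrite p1E.
have A22 u : I u -> A 2 2 u = 0.
  move=> Iu; rewrite -[RHS](triple_r (x^~ u) (fun i => (x i)^`(2) u)).
  by apply: eq_bigr => i _; rewrite p2E.
have A01 u : I u -> A 0 1 u = 0.
  move=> Iu; have := A_leibniz Iu A00 (has_derive_cst 1 u).
  by rewrite A10// add0r.
have A02 : A 0 2 t = 0.
  by have := A_leibniz It A01 (has_derive_cst 0 t); rewrite A11// add0r.
have A20 : A 2 0 t = 0.
  by have := A_leibniz It A10 (has_derive_cst 0 t); rewrite A11// addr0.
have A21 u : I u -> A 2 1 u = - A 1 2 u.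
  move=> Iu; have /eqP := A_leibniz Iu A11 (has_derive_cst 0 u).
  by rewrite addr_eq0 => /eqP.
(* Differentiating p''q' = - p'q'' gives p'''q' + p''q'' = - (p''q'' + p'q'''), where p''q'' = 0. *)
have A31 : A 3 1 t = - A 1 3 t.
  have := A_leibniz It A21 (has_deriveN (dA 1 2 It)).
  by rewrite A22// addr0 add0r.
have A32 : A 3 2 t = - A 2 3 t.
  have /eqP := A_leibniz It A22 (has_derive_cst 0 t).
  by rewrite addr_eq0 => /eqP.
exists (A 1 3 t), (A 2 3 t).
have A21t : A 2 1 t = - D := etrans (A21 t It) (congr1 -%R A12).
split; split.
- exact: A10.
- exact: A11.
- exact: A12.
- exact: erefl.
- exact: A20.
- exact: A21t.
- exact: A22.
- exact: erefl.
- exact: (etrans (congr1 -%R (A01 _ It)) (oppr0 _)).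
- exact: (etrans (congr1 -%R (A11 _ It)) (oppr0 _)).
- exact: (etrans (congr1 -%R A21t) (opprK _)).
- exact: (etrans (congr1 -%R A31) (opprK _)).
- exact: (etrans (congr1 -%R A02) (oppr0 _)).
- exact: (congr1 -%R A12).
- exact: (etrans (congr1 -%R (A22 _ It)) (oppr0 _)).
- exact: (etrans (congr1 -%R A32) (opprK _)).
Qed.

End Relations.
End Dancing.

(** * Smoothness of the change of parameter and of lift *)

Section Transition.
Variable R : realType.
Local Notation "f ^` ( n )" := (derive1n n f) : ring_scope.

Lemma smooth_on_coord m n (I : set R) (q : R -> 'M[R]_(m.+1, n.+1)) i j :
  open I -> smooth_on I q -> (forall k, Ck k I (fun t => q t i j)) /\
  forall k t, I t -> (q^`(k) t) i j = (fun t => q t i j)^`(k) t.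
Proof.
move=> oI sq.
have dq k t : I t -> has_derive (fun x => q^`(k) x i j) t (q^`(k.+1) t i j).
  move=> It; have dqt := sq k t It.
  have dqij := (derivable_mxP _ _ _).1 dqt i j.
  apply: has_derive_val (derivable_has_derive dqij) _.
  by rewrite derive1nS !derive1E derive_mx// mxE.
have E k t : I t -> (q^`(k) t) i j = (fun t => q t i j)^`(k) t.
  elim: k t => [//|k ih] t It.
  rewrite -(has_derive_derive1 (dq k t It)) [in RHS]derive1nS.
  exact: derive1_eq_on ih It.
split=> // k.
suff H l : Ck k I (fun t => q^`(l) t i j) by exact: (H 0%N).
elim: k l => [//|k ih] l; split; first by move=> t /(dq l)/has_derive_derivable.
apply: Ck_eq_on (ih l.+1) => // t It.
by rewrite -(has_derive_derive1 (dq l t It)).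
Qed.

(** If all minors with a fixed nonzero entry a_i vanished, b would be (b_i / a_i) a. For a = Q, b =
    Q' the minor makes Q_j / Q_i a local coordinate with nonzero derivative. *)
Lemma free2_minor m n (a b : 'M[R]_(m, n)) : free [:: a; b] ->
  exists i j, a i.1 i.2 != 0 /\
    b j.1 j.2 * a i.1 i.2 - a j.1 j.2 * b i.1 i.2 != 0.
Proof.
rewrite (perm_free (_ : perm_eq _ [:: b; a])); last by rewrite (perm_catC [:: a] [:: b]).
rewrite free_cons span_seq1 seq1_free => /andP[bNa a0].
have [i ai] : exists i : 'I_m * 'I_n, a i.1 i.2 != 0.
  apply: contrapT => H; move/eqP: a0; apply; apply/matrixP => i1 i2; rewrite mxE.
  by apply/eqP; apply: contrapT => /negP ai; apply: H; exists (i1, i2).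
exists i; apply: contrapT => H; move/negP: bNa; apply; apply/vlineP.
exists (b i.1 i.2 / a i.1 i.2); apply/matrixP => j1 j2; rewrite mxE.
apply: (mulIf ai); rewrite mulrAC divfK//; apply/eqP; rewrite mulrC -subr_eq0 mulrC [_ * a _ _]mulrC.
apply: contrapT => /negP bj; apply: H; exists (j1, j2); split=> //=.
by rewrite [X in X - _]mulrC [X in _ - X]mulrC.
Qed.

Lemma represents_scale m n (a b : 'M[R]_(m, n)) P : represents a P ->
  represents b P -> a != 0 -> exists2 l, l != 0 & a = l *: b.
Proof.
rewrite /represents => -> ab a0.
have /vlineP[l al] : a \in <[b]>%VS by rewrite -ab memv_line.
by exists l => //; apply: contraNneq a0 => l0; rewrite al l0 scale0r.
Qed.

(** The parameter [s] is only given as an inverse of [c']. Its smoothness comes from the ratio of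
    two coordinates, which is the same for all lifts: (Q_j / Q_i)(s(c t)) = (q_j / q_i)(t). The
    factor is then l = Q_i(s(c t)) / q_i(t). *)
Lemma transition_smooth m n (g : curve R m n) I (c : R -> g) q U (s : g -> R) c' Q t0 :
  parametrization I c q -> open U -> parametrization (s @` U) c' Q ->
  (forall x, U x -> c' (s x) = x) -> I t0 -> U (c t0) ->
  exists N l, [/\ open N, N t0, (forall k, Ck k N (s \o c)), (forall k, Ck k N l)
    & forall t, N t ->
      [/\ I t, U (c t), l t != 0 & Q (s (c t)) = l t *: q t]].
Proof.
move=> [oI sq rq cc _] oU [oS sQ rQ _ c'o] c'K It0 Ut0.
have s_cont x : U x -> {for x, continuous s}.
  move=> Ux W /=; rewrite {1}nbhsE /= => -[V [oV Vs] VW].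
  apply: (@filterS _ _ _ (c' @` (V `&` s @` U))).
    by move=> _ [z [Vz [y Uy yz]] <-]; rewrite /= -yz c'K// yz; exact: VW.
  apply: open_nbhs_nbhs; split.
    by apply: c'o; [exact: openI|move=> ? []].
  by exists (s x); [split=> //; exists x|exact: c'K].
have sc_cont t : I t -> U (c t) -> {for t, continuous (s \o c)}.
  by move=> It Uct; apply: continuous_comp; [exact: cc|exact: s_cont].
have SU x : U x -> (s @` U) (s x) by move=> Ux; exists x.
have prop t : I t -> U (c t) -> exists2 l, l != 0 & Q (s (c t)) = l *: q t.
  move=> It Uct; have [rQt /free_not0 fQ] := rQ _ (SU _ Uct).
  rewrite c'K// in rQt; have [rqt _] := rq _ It.
  by apply: represents_scale rQt rqt (fQ _ _); rewrite mem_head.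
have [_ /free2_minor[i [j [fi0 W0]]]] := rQ _ (SU _ Ut0).
pose f (i : 'I_m.+1 * 'I_n.+1) y := Q y i.1 i.2.
pose x (i : 'I_m.+1 * 'I_n.+1) t := q t i.1 i.2.
have cf h k : Ck k (s @` U) (f h) by have [] := smooth_on_coord h.1 h.2 oS sQ.
have cx h k : Ck k I (x h) by have [] := smooth_on_coord h.1 h.2 oI sq.
(* The numerator of the derivative of f_j / f_i. *)
pose w (y : R) := derive1 (f j) y * f i y - f j y * derive1 (f i) y.
have cw k : Ck k (s @` U) w.
  apply: CkD => //; first by apply: CkM => //; exact: (cf j k.+1).2.
  by apply: CkN => //; apply: CkM => //; exact: (cf i k.+1).2.
have [N' [oN' N'0 N'P]] : exists N', [/\ open N', N' (s (c t0))
    & forall y, N' y -> [/\ (s @` U) y, f i y != 0 & w y != 0]].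
  have Sy0 := SU _ Ut0.
  have w0 : w (s (c t0)) != 0.
    have dQ h : derive1 (f h) (s (c t0)) = (Q^`(1) (s (c t0))) h.1 h.2.
      by rewrite (smooth_on_coord h.1 h.2 oS sQ).2.
    by rewrite /w !dQ.
  have : \forall y \near s (c t0), [/\ (s @` U) y, f i y != 0 & w y != 0].
    near=> y; split; near: y.
    - exact: open_nbhs_nbhs.
    - exact: (cvgr_neq0 _ (Ck_continuous (cf i 1%N) Sy0) fi0).
    - exact: (cvgr_neq0 _ (Ck_continuous (cw 1%N) Sy0) w0).
  by rewrite /prop_near1 nbhsE => -[N' [oN' N'0] N'P]; exists N'.
have [N [oN N0 NP]] : exists N, [/\ open N, N t0
    & forall t, N t -> [/\ I t, U (c t) & N' (s (c t))]].
  have : \forall t \near t0, [/\ I t, U (c t) & N' (s (c t))].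
    near=> t; split; near: t.
    - exact: open_nbhs_nbhs.
    - by apply: (cc _ It0 U); exact: open_nbhs_nbhs.
    - by apply: (sc_cont _ It0 Ut0 N'); exact: open_nbhs_nbhs.
  by rewrite /prop_near1 nbhsE => -[N [oN N0] NP]; exists N.
have xi0 t : N t -> x i t != 0.
  move=> /NP[It Uct /N'P[_ fi _]]; have [l l0 e] := prop _ It Uct.
  by apply: contraNneq fi => xi; rewrite /f e mxE -/(x i t) xi mulr0.
have NI : N `<=` I by move=> t /NP[].
have N'S : N' `<=` s @` U by move=> t /N'P[].
have csc : forall k, Ck k N (s \o c).
  apply: (@Ck_implicit _ N N' (fun t => x j t * (x i t)^-1)
    (fun y => f j y * (f i y)^-1)) => //.
  - by move=> t /NP[].
  - by move=> t /NP[It Uct _]; exact: sc_cont.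
  - move=> t Nt; have [It Uct _] := NP _ Nt; have [l l0 e] := prop _ It Uct.
    rewrite /f /= e !mxE -/(x i t) -/(x j t); field.
    by rewrite l0 xi0.
  - move=> y N'y; have [Sy fi wy] := N'P _ N'y.
    have df h : has_derive (f h) y (derive1 (f h) y).
      exact: (Ck_has_derive 0 (cf h) Sy).
    rewrite (has_derive_derive1 (has_deriveM (df j) (has_deriveV fi (df i)))).
    apply: contraNneq wy => e; apply/eqP.
    transitivity (f i y ^+ 2 * 0); last by rewrite mulr0.
    by rewrite -e /w; field.
  - move=> k; apply: CkM => //; first exact: Ck_subset (cx j k).
    by apply: CkV => //; exact: Ck_subset (cx i k).
  - move=> k; apply: CkM => //; first exact: Ck_subset (cf j k).
    apply: CkV => //; last exact: Ck_subset (cf i k).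
    by move=> y /N'P[].
exists N, (fun t => f i (s (c t)) * (x i t)^-1); split=> //.
  move=> k; apply: CkM => //.
    apply: (@Ck_comp _ _ N N' (f i) (s \o c)) => //; first by move=> t /NP[].
    exact: Ck_subset (cf i k).
  by apply: CkV => //; exact: Ck_subset (cx i k).
move=> t Nt; have [It Uct /N'P[_ fi _]] := NP _ Nt; split=> //.
  by rewrite mulf_neq0// invr_neq0// xi0.
have [l l0 e] := prop _ It Uct; rewrite {1}e; congr (_ *: _).
by rewrite /f e mxE -/(x i t) mulfK// xi0.
Unshelve. all: by end_near. Qed.

End Transition.

(** * Comparison of the natural projective structures *)

Section Main.
Variable R : realType.
Local Notation "f ^` ( n )" := (derive1n n f) : ring_scope.

(** A chart of the natural atlas seen from the given parameter t: [X] is the given lift, [Y] the one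
    in Laguerre-Forsyth form, s(t) its parameter and l(t) the factor between the two. *)
Definition Laguerre_Forsyth_lift (N : set R) (X : 'I_3 -> R -> R) (s l : R -> R) :=
  exists N' (Y : 'I_3 -> R -> R) (a0 : R -> R),
  [/\ open N', forall i k, Ck k N' (Y i), forall k, Ck k N s, forall k, Ck k N l
    & [/\ forall t, N t -> N' (s t), forall t, N t -> l t != 0,
          forall i t, N t -> Y i (s t) = l t * X i t
        & forall i y, N' y -> (Y i)^`(3) y + a0 y * Y i y = 0]].

Lemma Laguerre_Forsyth_lift_relations N X s l t (a b : 'I_3 -> R) (B D E : R) :
  open N -> (forall i k, Ck k N (X i)) -> Laguerre_Forsyth_lift N X s l ->
  N t -> D != 0 ->
  [/\ pairing a (fun i => X i t) = 0, pairing a (fun i => (X i)^`(1) t) = 0,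
      pairing a (fun i => (X i)^`(2) t) = D
    & pairing a (fun i => (X i)^`(3) t) = B] ->
  [/\ pairing b (fun i => X i t) = 0, pairing b (fun i => (X i)^`(1) t) = - D,
      pairing b (fun i => (X i)^`(2) t) = 0
    & pairing b (fun i => (X i)^`(3) t) = E] ->
  [/\ s^`(1) t != 0, s^`(2) t / s^`(1) t = l^`(1) t / l t + B / (3 * D)
    & 3 * (s^`(2) t / s^`(1) t) ^+ 2
      - 6 * (s^`(2) t / s^`(1) t) * (l^`(1) t / l t)
      - s^`(3) t / s^`(1) t + 3 * (l^`(2) t / l t) = E / D].
Proof.
move=> oN cX [N' [Y [a0 [oN' cY cs cl [sN l0 e0 ode]]]]] Nt D0 aX bX.
have J i := derive1n_comp_mul oN oN' sN (cY i) (cX i) cs cl (e0 i) Nt.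
exact: (Laguerre_Forsyth_relations (fun i => e0 i t Nt) J
  (fun i => ode i _ (sN _ Nt)) (l0 _ Nt) D0 aX bX).
Qed.

(** Used for s'' / s' with n = 1 and for l' / l with n = 0. *)
Lemma has_derive_log_derive N (f : R -> R) n t : (forall k, Ck k N f) -> N t ->
  f^`(n) t != 0 ->
  has_derive (fun u => f^`(n.+1) u * (f^`(n) u)^-1) t
    (f^`(n.+2) t / f^`(n) t - (f^`(n.+1) t / f^`(n) t) ^+ 2).
Proof.
move=> cf Nt f0; apply: has_derive_val (has_deriveM (Ck_has_derive n.+1 cf Nt)
  (has_deriveV f0 (Ck_has_derive n cf Nt))) _.
by move: (f^`(n) t) (f^`(n.+1) t) (f^`(n.+2) t) f0 => a b c a0; field.
Qed.

(** Here h = s''/s', h' = s'''/s', a = l'/l, a' = l''/l, and likewise k, b for the dual curve, so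
    the derivative of h is h' - h^2. The last hypothesis is the derivative of h - k = a - b.
    Eliminating a' - b' between it and the difference of the two second-order relations leaves the
    claim. *)
Let Riccati_of_Laguerre_Forsyth (h h' k k' a a' b b' c e : R) :
  h = a + c -> 3 * h ^+ 2 - 6 * h * a - h' + 3 * a' = e ->
  k = b + c -> 3 * k ^+ 2 - 6 * k * b - k' + 3 * b' = e ->
  h' - h ^+ 2 - (k' - k ^+ 2) = a' - a ^+ 2 - (b' - b ^+ 2) ->
  h' - h ^+ 2 - (k' - k ^+ 2) = (h ^+ 2 - k ^+ 2) / 2.
Proof. by move=> -> Eh -> Ek E; lra. Qed.

(** B, D and E are common to the two curves at each point. The term B / (3 D) therefore cancels in
    s''/s' - r''/r' = l'/l - m'/m, and this identity is differentiated, so no derivative of a2 is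
    taken. *)
Lemma dancing_same_schwarzian (I : set R) (x p : 'I_3 -> R -> R)
    (N : set R) (s l r m : R -> R) :
  open I -> (forall i k, Ck k I (x i)) -> (forall i k, Ck k I (p i)) ->
  (forall t, I t -> pairing (p^~ t) (x^~ t) = 1) ->
  (forall t, I t -> forall i, (p i)^`(1) t =
    x (i + 1) t * (x (i + 2%:R))^`(1) t - x (i + 2%:R) t * (x (i + 1))^`(1) t) ->
  (forall t, I t ->
    triple (x^~ t) (fun i => (x i)^`(1) t) (fun i => (x i)^`(2) t) != 0) ->
  open N -> N `<=` I ->
  Laguerre_Forsyth_lift N x s l -> Laguerre_Forsyth_lift N p r m ->
  forall t, N t -> [/\ s^`(1) t != 0, r^`(1) t != 0
    & has_derive (fun u => s^`(2) u / s^`(1) u - r^`(2) u / r^`(1) u) t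
       (((s^`(2) t / s^`(1) t) ^+ 2 - (r^`(2) t / r^`(1) t) ^+ 2) / 2)].
Proof.
move=> oI cx cp px1 p1E D0 oN NI sl rm.
have cxN i k : Ck k N (x i) by exact: Ck_subset (cx i k).
have cpN i k : Ck k N (p i) by exact: Ck_subset (cp i k).
have rel t : N t -> exists B D E,
  [/\ s^`(1) t != 0, s^`(2) t / s^`(1) t = l^`(1) t / l t + B / (3 * D)
    & 3 * (s^`(2) t / s^`(1) t) ^+ 2
      - 6 * (s^`(2) t / s^`(1) t) * (l^`(1) t / l t)
      - s^`(3) t / s^`(1) t + 3 * (l^`(2) t / l t) = E / D] /\
  [/\ r^`(1) t != 0, r^`(2) t / r^`(1) t = m^`(1) t / m t + B / (3 * D)
    & 3 * (r^`(2) t / r^`(1) t) ^+ 2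
      - 6 * (r^`(2) t / r^`(1) t) * (m^`(1) t / m t)
      - r^`(3) t / r^`(1) t + 3 * (m^`(2) t / m t) = E / D].
  move=> Nt; have It := NI _ Nt.
  have [B [E [pa pb qa qb]]] := dancing_relations oI cx cp px1 p1E It
    (frefl _) (frefl _) (frefl _) (frefl _) (frefl _) (frefl _) (frefl _) (frefl _).
  exists B, (triple (x^~ t) (fun i => (x i)^`(1) t) (fun i => (x i)^`(2) t)), E.
  split; [apply: (Laguerre_Forsyth_lift_relations oN cxN sl Nt (D0 _ It) pa pb)|].
  exact: (Laguerre_Forsyth_lift_relations oN cpN rm Nt (D0 _ It) qa qb).
have [_ [_ [_ [_ _ cs cl [_ l0 _ _]]]]] := sl.
have [_ [_ [_ [_ _ cr cm [_ m0 _ _]]]]] := rm.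
move=> t Nt; have [B [D [E [[s10 hs Es] [r10 hr Er]]]]] := rel t Nt.
split=> //.
have dh := has_deriveD (has_derive_log_derive cs Nt s10)
  (has_deriveN (has_derive_log_derive cr Nt r10)).
have dl := has_deriveD (has_derive_log_derive (n := 0) cl Nt (l0 _ Nt))
  (has_deriveN (has_derive_log_derive (n := 0) cm Nt (m0 _ Nt))).
apply: (has_derive_val dh).
have hl u : N u -> s^`(2) u * (s^`(1) u)^-1 + - (r^`(2) u * (r^`(1) u)^-1)
    = l^`(1) u * (l^`(0) u)^-1 + - (m^`(1) u * (m^`(0) u)^-1).
  move=> /rel[B' [D' [E' [[_ e1 _] [_ e2 _]]]]].
  by apply: (etrans (congr2 (fun a b => a - b) e1 e2)); rewrite opprD addrACA subrr addr0.
have := derive1_eq_on oN hl Nt.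
rewrite (has_derive_derive1 dh) (has_derive_derive1 dl).
exact: Riccati_of_Laguerre_Forsyth hs Es hr Er.
Qed.

Lemma moebius_homog (A : 'M[R]_2) (s r c : R) (P P' : RP1 R) :
  A *m homog s = c *: homog r -> c != 0 ->
  represents (homog s) P -> represents (homog r) P' -> moebius A P P'.
Proof.
rewrite /moebius => Ac c0 -> ->; rewrite limg_line lfunE /= Ac.
apply/eqP; rewrite eqEsubv -!memvE memvZ ?memv_line// andbT.
by rewrite -{1}[homog r](scalerK c0) memvZ ?memv_line.
Qed.

(** Solving for r gives r = r0 + b (s - s0) / (a + d (s - s0)); [A] is the matrix of this fraction,
    of determinant a b. *)
Lemma moebius_relation (s0 r0 a b d : R) : a != 0 -> b != 0 ->
  exists2 A : 'M[R]_2, A \in unitmx & forall s r,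
    (r - r0) * (a + d * (s - s0)) = b * (s - s0) ->
    exists2 c, c != 0 & A *m homog s = c *: homog r.
Proof.
move=> a0 b0.
pose A : 'M[R]_2 := \matrix_(i, j)
  if i == ord0 then if j == ord0 then b + r0 * d else a * r0 - b * s0 - r0 * s0 * d
  else if j == ord0 then d else a - d * s0.
exists A.
  have -> : A \in unitmx = (\det A != 0) by rewrite unitmxE unitfE.
  have -> : \det A = a * b.
    rewrite (expand_det_row _ ord0) !big_ord_recl big_ord0 /cofactor.
    rewrite !det_mx11 !mxE /= /bump /= !add0n expr0 expr1; ring.
  by rewrite mulf_neq0.
(* The factor is the denominator of the fraction. If it vanished, the relation would give s = s0,
   and the denominator would be a. *)
move=> s r e; exists (a + d * (s - s0)).
  apply: contraNneq a0 => c0; move: e; rewrite c0 mulr0 => /esym/eqP.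
  rewrite mulf_eq0 (negPf b0) /= => /eqP s0E; move: c0.
  by rewrite s0E mulr0 addr0 => ->.
apply/matrixP => i j; rewrite !mxE !big_ord_recl big_ord0 !mxE /= addr0.
case: (i == ord0); last by ring.
transitivity (b * (s - s0) + r0 * (a + d * (s - s0))); first by ring.
by rewrite -e; ring.
Qed.

(** The map [w] lists the three matrix positions, so that columns and rows are covered at once. All
    smaller open sets are allowed, for the two curves to be compared on a common one. *)
Lemma chart_Laguerre_Forsyth_lift m n (g : curve R m n) I (c : R -> g) q
    U (s : g -> R) c' Q a0 t0 (w : 'I_3 -> 'I_m.+1 * 'I_n.+1) :
  parametrization I c q -> open U -> parametrization (s @` U) c' Q ->
  (forall x, U x -> c' (s x) = x) ->
  (forall y, (s @` U) y -> Q^`(3) y + a0 y *: Q y = 0) -> I t0 -> U (c t0) ->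
  exists N l, [/\ open N, N t0, (forall t, N t -> I t /\ U (c t))
    & forall N0, open N0 -> N0 `<=` N ->
      Laguerre_Forsyth_lift N0 (fun i t => q t (w i).1 (w i).2) (s \o c) l].
Proof.
move=> qp oU Qp c'K ode It0 Ut0.
have [oS sQ _ _ _] := Qp.
have [N [l [oN N0 cs cl Nt]]] := transition_smooth qp oU Qp c'K It0 Ut0.
exists N, l; split=> //; first by move=> t /Nt[].
move=> N1 oN1 N1N; exists (s @` U), (fun i y => Q y (w i).1 (w i).2), a0; split.
- exact: oS.
- by move=> i; exact: (smooth_on_coord _ _ oS sQ).1.
- by move=> k; exact: Ck_subset (cs k).
- by move=> k; exact: Ck_subset (cl k).
split.
- by move=> t /N1N/Nt[_ Uct _ _]; exists (c t).
- by move=> t /N1N/Nt[].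
- by move=> i t /N1N/Nt[_ _ _ /= ->]; rewrite mxE.
move=> i y Sy; rewrite -(smooth_on_coord _ _ oS sQ).2//.
by have /matrixP/(_ (w i).1 (w i).2) := ode _ Sy; rewrite !mxE.
Qed.

End Main.

Theorem proposition5p8 (R : realType)
    (gamma : plane_curve R) (gammabar : dual_plane_curve R)
    (gamma_convex : locally_convex_curve (@det_col R) gamma)
    (gammabar_convex : locally_convex_curve (@det_row R) gammabar)
    (I : set R) (I_itv : is_interval I)
    (cq : R -> gamma) (q : R -> 'cV[R]_3)
    (cp : R -> gammabar) (p : R -> 'rV[R]_3)
    (q_param : parametrization I cq q) (q_surj : cq @` I = setT)
    (p_param : parametrization I cp p) (p_surj : cp @` I = setT)
    (dancing : dancing_pair I q p)
    (f : gamma -> gammabar) (f_q_p : forall t, I t -> f (cq t) = cp t) :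
  projective_map (@natural_atlas R _ _ gamma)
                 (@natural_atlas R _ _ gammabar) f.
Proof.
have [oI sq _ _ cqo] := q_param; have [_ sp _ cpc _] := p_param.
have surj x : exists2 t, I t & cq t = x.
  by have : (cq @` I) x by rewrite q_surj.
(* [cq] need not be injective; as an open map it turns statements about parameters near t into
   statements about points near [cq t]. *)
have cq_nbhs (J : set R) t : open J -> J `<=` I -> J t -> nbhs (cq t) (cq @` J).
  by move=> oJ JI Jt; apply: open_nbhs_nbhs; split; [exact: cqo|exists t].
split.
  move=> x W; have [t It <-] := surj x; rewrite f_q_p// => /(cpc t It).
  rewrite nbhsE => -[J [oJ Jt] JW].
  apply: filterS (cq_nbhs (J `&` I) t (openI oJ oI) (@subIsetr _ _ _) (conj Jt It)).
  by move=> _ [u [Ju Iu] <-]; rewrite /= f_q_p//; exact: JW.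
move=> phi psi x [oU [s [sphi [c1 [Q [a0 [Qp c1K Qode]]]]]]].
move=> [oV [r [rpsi [c2 [P [b0 [Pp c2K Pode]]]]]]].
have [t0 It0 <-] := surj x; move=> Ut0; rewrite f_q_p// => Vt0.
pose X (i : 'I_3) t := q t i ord0; pose Y (i : 'I_3) t := p t ord0 i.
have [N1 [l [oN1 N1t0 N1P Lq]]] :=
  chart_Laguerre_Forsyth_lift (fun i => (i, ord0)) q_param oU Qp c1K Qode It0 Ut0.
have [N2 [m [oN2 N2t0 N2P Lp]]] :=
  chart_Laguerre_Forsyth_lift (fun i => (ord0, i)) p_param oV Pp c2K Pode It0 Vt0.
(* The Moebius relation rests on functions with zero derivative being constant, so the common domain
   is shrunk to an interval. *)
have [a [b [t0ab abN]]] : exists a b, t0 \in `]a, b[%R /\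
    forall t, t \in `]a, b[%R -> N1 t /\ N2 t.
  have : nbhs t0 (N1 `&` N2) by apply: open_nbhs_nbhs; split=> //; exact: openI.
  move=> /nbhs_ballP[e /= e0 eN]; exists (t0 - e), (t0 + e); split.
    by rewrite in_itv /= ltrBlDr ltrDl e0.
  by move=> t; rewrite in_itv /= => te; apply: eN; rewrite /ball /= ltr_distlC.
pose N : set R := [set` `]a, b[%R].
have oN : open N by exact: interval_open.
have NN1 : N `<=` N1 by move=> t /abN[].
have NN2 : N `<=` N2 by move=> t /abN[].
have NI : N `<=` I by move=> t /NN1/N1P[].
have {Lq} Lq : Laguerre_Forsyth_lift N X (s \o cq) l by exact: Lq.
have {Lp} Lp : Laguerre_Forsyth_lift N Y (r \o cp) m by exact: Lp.
have cX i k : Ck k I (X i) by exact: (smooth_on_coord i ord0 oI sq).1.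
have cY i k : Ck k I (Y i) by exact: (smooth_on_coord ord0 i oI sp).1.
have dX i k t : I t -> (derive1n k q t) i ord0 = derive1n k (X i) t.
  exact: (smooth_on_coord i ord0 oI sq).2.
have px1 t : I t -> pairing (Y^~ t) (X^~ t) = 1.
  move=> /dancing[/matrixP/(_ ord0 ord0)]; rewrite !mxE => e _.
  exact: e.
have p1E t : I t -> forall i, derive1n 1 (Y i) t =
    X (i + 1) t * derive1n 1 (X (i + 2%:R)) t
    - X (i + 2%:R) t * derive1n 1 (X (i + 1)) t.
  move=> It i; rewrite -!dX// -(smooth_on_coord ord0 i oI sp).2//.
  by have [_ /matrixP/(_ ord0 i)] := dancing t It; rewrite mxE.
have D0 t : I t -> triple (X^~ t) (fun i => derive1n 1 (X i) t)
    (fun i => derive1n 2 (X i) t) != 0.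
  move=> It; have := gamma_convex _ _ _ q_param _ It; rewrite det_colE.
  congr (triple _ _ _ != 0); apply/funext => i.
    exact: (dX i 1%N).
  exact: (dX i 2%N).
have S := dancing_same_schwarzian oI cX cY px1 p1E D0 oN NI Lq Lp.
have [_ [_ [_ [_ _ cs _ _]]]] := Lq.
have [_ [_ [_ [_ _ cr _ _]]]] := Lp.
have rel t : N t -> _ := same_schwarzian_moebius
  (fun u Nu => And4 (Ck_has_derive 0 cs Nu) (Ck_has_derive 1 cs Nu)
     (Ck_has_derive 0 cr Nu) (Ck_has_derive 1 cr Nu))
  (fun u Nu => let: And3 s1 r1 _ := S u Nu in conj s1 r1)
  (fun u _ => erefl) (fun u Nu => let: And3 _ _ d := S u Nu in d) t0ab.
have [s10 r10 _] := S _ t0ab.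
(* The matrix depends only on the 2-jets of the two parameters at [t0], so a single [A] serves all t
   in [N]. *)
have [A uA AP] := moebius_relation ((s \o cq) t0) ((r \o cp) t0)
  ((derive1n 2 (s \o cq) t0 / derive1n 1 (s \o cq) t0
    - derive1n 2 (r \o cp) t0 / derive1n 1 (r \o cp) t0) / 2) s10 r10.
exists A; split=> //.
apply: filterS (cq_nbhs N t0 oN NI t0ab) => _ [t Nt <-].
have [_ Ut] := N1P _ (NN1 _ Nt); have [_ Vt] := N2P _ (NN2 _ Nt).
rewrite f_q_p; last exact: NI.
have [c c0 Ac] := AP _ _ (rel t Nt).
exact: moebius_homog Ac c0 (sphi _ Ut) (rpsi _ Vt).
Qed.
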